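(* Let $X$ be a metric space on $n$ points and write $q(tX):=n-|tX|$. Then, as $t\to\infty$, we have the asymptotic equivalence $$n-|tX| = q(tX)\,\sim\, n^2\left(\frac{n-1}{n}-2R(S_t)^2\right).$$
   Context: Metric spaces $(X,d)$ are finite and nonempty. For $t>0$, $tX=(X,t\cdot d)$. The similarity matrix $Z(X)\in\mathbb{R}^{X\times X}$ has entries $e^{-d(i,j)}$; $X$ is positive definite if $Z(X)$ is positive definite, in which case its magnitude is $|X|=\mathbf{1}^TZ(X)^{-1}\mathbf{1}$, with $\mathbf{1}$ the all-ones vector. For every finite metric space $X$, $tX$ is positive definite for all sufficiently large $t$. A similarity embedding of a positive definite metric space $(X,d)$ on $n$ points is a map $\varphi:X\to\mathbb{R}^{n-1}$ with $\|\varphi(i)-\varphi(j)\|^2=1-e^{-d(i,j)}$ for all $i,j$; it exists, is unique up to isometries, and its image is a set of $n$ affinely independent points. For $t$ large enough that $tX$ is positive definite, $S_t$ denotes the image of the similarity embedding of $tX$, and $R(S_t)$ is its circumradius: the radius of the unique sphere in $\mathbb{R}^{n-1}$ through all points of $S_t$ (equal to $0$ if $n=1$). Asymptotic equivalence $f(t)\sim g(t)$ as $t\to\infty$ means $f(t)=(1+o(1))\,g(t)$. *)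

(* Defs.v *)
From HB Require Import structures.
From mathcomp Require Import all_boot all_order all_algebra.
From mathcomp Require Import all_classical all_reals all_analysis.

Set Implicit Arguments.
Unset Strict Implicit.
Unset Printing Implicit Defensive.

Import Order.TTheory GRing.Theory Num.Theory.
Import numFieldNormedType.Exports.

Local Open Scope classical_set_scope.
Local Open Scope ring_scope.

#[short(type="finMetricType")]
HB.structure Definition FinMetric (R : numDomainType) :=
  { X of Finite X & Metric R X }.

Canonical pinfty_filterType (R : numFieldType) :=
  FilterType (pinfty_nbhs R) _.

(* The norm `|v| of MathComp-Analysis on matrices is the sup norm, hence this
   definition. *)
Definition euclid_norm (R : realType) (m : nat) (v : 'rV[R]_m) : R :=
  Num.sqrt (\sum_k v ord0 k ^+ 2).

Definition posdefmx (R : realType) (m : nat) (A : 'M[R]_m) : Prop :=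
  A^T = A /\ forall v : 'rV[R]_m, v != 0 -> 0 < (v *m A *m v^T) ord0 ord0.

(* The notions below depend on a finite metric space only through its distance
   function; this makes the rescaled space tX = (X, t d) directly expressible,
   its distance function being [scale_dist t d]. *)
Definition scale_dist (R : realType) (X : Type) (t : R) (d : X -> X -> R) :
  X -> X -> R := fun x y => t * d x y.

Definition similarity_mx (R : realType) (X : finType) (d : X -> X -> R) :
  'M[R]_#|X| := \matrix_(i, j) expR (- d (enum_val i) (enum_val j)).

(* This is the magnitude when [similarity_mx d] is positive definite. *)
Definition magnitude (R : realType) (X : finType) (d : X -> X -> R) : R :=
  ((const_mx 1 : 'rV[R]_#|X|) *m invmx (similarity_mx d)
     *m (const_mx 1 : 'cV[R]_#|X|)) ord0 ord0.

Definition similarity_embedding (R : realType) (X : finType) (d : X -> X -> R)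
    (phi : X -> 'rV[R]_(#|X|.-1)) : Prop :=
  posdefmx (similarity_mx d) /\
  forall x y, euclid_norm (phi x - phi y) ^+ 2 = 1 - expR (- d x y).

(* The image of a similarity embedding. The embedding exists as soon as
   [similarity_mx d] is positive definite, but is unique only up to isometry,
   hence the choice operator. *)
Definition similarity_image (R : realType) (X : finType) (d : X -> X -> R) :
  set 'rV[R]_(#|X|.-1) := range (xget (fun=> 0) (similarity_embedding d)).

Definition sphere (R : realType) (m : nat) (c : 'rV[R]_m) (r : R) :
  set 'rV[R]_m := [set v | euclid_norm (v - c) = r].

(* The radius is unique when S consists of m.+1 affinely independent points;
   it is 0 when m = 0 and S is a point. *)
Definition circumradius (R : realType) (m : nat) (S : set 'rV[R]_m) : R :=
  xget 0 [set r | 0 <= r /\ exists c, S `<=` sphere c r].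

(* Main.v *)
Require Import Defs.
From HB Require Import structures.
From mathcomp Require Import all_boot all_order all_algebra.
From mathcomp Require Import all_classical all_reals all_analysis.
From mathcomp Require Import ring lra.

Set Implicit Arguments.
Unset Strict Implicit.
Unset Printing Implicit Defensive.

Import Order.TTheory GRing.Theory Num.Theory.
Import numFieldNormedType.Exports.

Local Open Scope classical_set_scope.
Local Open Scope ring_scope.

(** Write Z for the similarity matrix of tX and s = |tX|. The asymptotic
    equivalence rests on an exact identity, valid as soon as Z is positive
    definite:
      2 R(S_t)^2 = 1 - 1/s.
    It turns the right-hand side g(t) into n (n - s) / s, so that the two sides
    differ by q - g = ((s - n) / n) g, and everything reduces to s --> n.
    Since this difference is a multiple of g whether or not g vanishes, the
    degenerate case n = 1, where both sides are 0, needs no separate treatment.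

    The identity ([circumradius_simplex]) comes from barycentric coordinates.
    If the points p_i satisfy |p_i - p_j|^2 = 1 - Z_ij, then on coordinate
    vectors b of total mass 0 the squared length of sum_i b_i p_i is b Z b^T / 2
    ([embedding_quadratic_form]): the constant 1 in the squared distances is
    invisible to such b. Hence a point with barycentric coordinates a is at
    squared distance (1 + a Z a^T) / 2 - (a Z)_i from p_i
    ([sqdist_barycenter]), and it is equidistant from all the p_i exactly
    when a Z is constant, that is, when a is the weighting 1 Z^-1 divided by its
    mass s; the squared distance is then (1 - 1/s) / 2. Every centre has
    barycentric coordinates because n affinely independent points span an affine
    space of dimension n - 1 ([barycentric_coordinates]).

    Because the embedding is obtained by choice, the identity needs it to exist;
    it is built from a factorization L L^T of the Gram matrix of the vectors
    p_i - p_0 ([euclid_embedding_exists]).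

    Finally, distinct points of X are at positive distance, so the entries of Z
    tend to those of the identity matrix. This makes Z positive definite for
    large t ([posdefmx_near1]) and forces s --> n ([weight_near1]). *)

(** * Positive definite matrices *)

Lemma posdefmx_unit (R : realType) n (A : 'M[R]_n) :
  posdefmx A -> A \in unitmx.
Proof.
case=> _ Apos; rewrite -row_free_unit -kermx_eq0.
apply/eqP/row_matrixP => i; rewrite row0; apply/eqP/negPn/negP => /Apos.
by rewrite -row_mul mulmx_ker row0 mul0mx mxE ltxx.
Qed.

Lemma posdefmx_congr (R : realType) m n (T : 'M[R]_(m, n)) (A : 'M[R]_n) :
  row_free T -> posdefmx A -> posdefmx (T *m A *m T^T).
Proof.
move=> freeT [symA Apos]; split=> [|v v0].
  by rewrite !trmx_mul trmxK symA mulmxA.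
have: v *m T != 0.
  by apply: contra v0 => /eqP vT0; rewrite -(inj_eq (row_free_inj freeT)) vT0 mul0mx.
by move=> /Apos; rewrite trmx_mul !mulmxA.
Qed.

Lemma posdefmx_scale (R : realType) n (c : R) (A : 'M[R]_n) :
  0 < c -> posdefmx A -> posdefmx (c *: A).
Proof.
move=> c0 [symA Apos]; split=> [|v v0]; first by rewrite linearZ /= symA.
by rewrite -scalemxAr -scalemxAl mxE mulr_gt0 ?Apos.
Qed.

(** Cholesky factorization, by induction on the size: eliminating the first
    coordinate leaves the Schur complement S, which is positive definite because
    v S v^T is the value of the form at the vector extending v that minimizes
    it. *)
Lemma posdefmx_factor (R : realType) n (A : 'M[R]_n) :
  posdefmx A -> exists L : 'M[R]_n, L *m L^T = A.
Proof.
elim: n A => [|n IHn] A.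
  by move=> _; exists 0; rewrite [RHS]flatmx0 [LHS]flatmx0.
rewrite -[n.+1]/(1 + n)%N in A *.
move=> [symA Apos].
set b := dlsubmx A; set C := drsubmx A.
have bT : ursubmx A = b^T by rewrite trmx_dlsub symA.
have symC : C^T = C by rewrite trmx_drsub symA.
have defA : A = block_mx (A 0 0)%:M b^T b C.
  by rewrite -[LHS]submxK bT [ulsubmx A]mx11_scalar !mxE /= !lshift0.
move: (A 0 0) defA => a defA {bT}.
(* The corner is the value of the form at the first basis vector. *)
have a0 : 0 < a.
  have := Apos (row_mx 1%:M 0); rewrite defA mul_row_block !mul1mx !mul0mx.
  rewrite !addr0 tr_row_mx mul_row_col trmx1 trmx0 mulmx1 mulmx0 addr0 mxE /=.
  apply; apply/eqP => /matrixP/(_ 0 0); rewrite -[in LHS](lshift0 n 0).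
  by rewrite row_mxEl !mxE; apply/eqP/oner_neq0.
pose S := C - a^-1 *: (b *m b^T).
have [|L defS] := IHn S.
- split=> [|v v0].
    by rewrite /S linearB linearZ /= trmx_mul trmxK symC.
  (* The first coordinate cancels the first entry of the product with A. *)
  have := Apos (row_mx (- a^-1 *: (v *m b)) v); rewrite defA mul_row_block.
  rewrite mul_mx_scalar scalerA mulrN divff ?gt_eqF// scaleN1r addNr.
  rewrite tr_row_mx mul_row_col mul0mx add0r -scalemxAl -mulmxA !scaleNr addrC.
  rewrite [v *m S]mulmxBr -scalemxAr; apply.
  by apply: contra v0 => /eqP/(congr1 rsubmx); rewrite row_mxKr linear0 => ->.
exists (block_mx (Num.sqrt a)%:M 0 ((Num.sqrt a)^-1 *: b) L).
rewrite defA tr_block_mx mulmx_block !trmx0 !mul0mx !mulmx0 !addr0.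
rewrite tr_scalar_mx -scalar_mxM -expr2 sqr_sqrtr ?ltW// linearZ /=.
have sa0 : Num.sqrt a != 0 by rewrite gt_eqF ?sqrtr_gt0.
rewrite mul_scalar_mx mul_mx_scalar !scalerA divff// !scale1r.
rewrite -scalemxAl -scalemxAr scalerA -invfM -expr2 sqr_sqrtr ?ltW//.
by rewrite defS /S addrC subrK.
Qed.

(** * Similarity embeddings in barycentric coordinates *)

(** The first point is placed at the origin. The rows of T are the differences
    e_i - e_0 of basis vectors, so that T A T^T / 2 is the Gram matrix wanted for
    the other points; this is where one dimension is saved. Every b of mass 0 is
    a combination of the rows of T, hence the formula for all such b. *)
Lemma euclid_embedding_exists (R : realType) n (A : 'M[R]_n) :
  (0 < n)%N -> posdefmx A ->
  exists P : 'M[R]_(n, n.-1), forall b : 'rV[R]_n,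
    b *m (const_mx 1 : 'cV[R]_n) = 0 ->
    (b *m P) *m (b *m P)^T = 2^-1 *: (b *m A *m b^T).
Proof.
case: n A => // n; rewrite -[n.+1]/(1 + n)%N /= => A _ posA.
pose T : 'M[R]_(n, 1 + n) := row_mx (- const_mx 1) 1%:M.
have freeT : row_free T.
  by apply/row_freeP; exists (col_mx 0 1%:M); rewrite mul_row_col mulmx0 add0r mulmx1.
have half0 : 0 < (2^-1 : R) by rewrite invr_gt0.
have [L defL] := posdefmx_factor (posdefmx_scale half0 (posdefmx_congr freeT posA)).
exists (col_mx 0 L) => b; rewrite -{1 2 3}[b]hsubmxK -{1}(@col_mx_const _ 1 n).
rewrite !mul_row_col !mulmx0 !add0r => /(canRL (addrK _)).
rewrite sub0r [const_mx 1 as X in _ *m X]mx11_scalar mxE mulmx1 => b0.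
have -> : b *m A *m b^T = rsubmx b *m T *m A *m (rsubmx b *m T)^T.
  by rewrite mul_mx_row mulmx1 mulmxN -b0 hsubmxK.
by rewrite !trmx_mul !mulmxA -(mulmxA (rsubmx b)) defL -scalemxAr -scalemxAl !mulmxA.
Qed.

Lemma tr_mx11 (R : realType) (A : 'M[R]_1) : A^T = A.
Proof. by rewrite [A]mx11_scalar tr_scalar_mx. Qed.

Lemma sqr_euclid_norm (R : realType) m (v : 'rV[R]_m) :
  euclid_norm v ^+ 2 = (v *m v^T) 0 0.
Proof.
rewrite sqr_sqrtr; last by apply: sumr_ge0 => k _; exact: sqr_ge0.
by rewrite mxE; apply: eq_bigr => k _; rewrite mxE expr2.
Qed.

(** By polarization, the Gram matrix of the points is A / 2 up to a term that
    depends on the row only and one that depends on the column only; both are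
    killed by vectors of mass 0. *)
Lemma embedding_quadratic_form (R : realType) n m (A : 'M[R]_n) (P : 'M[R]_(n, m)) :
  (forall i j, euclid_norm (row i P - row j P) ^+ 2 = 1 - A i j) ->
  forall b : 'rV[R]_n, b *m (const_mx 1 : 'cV[R]_n) = 0 ->
    (b *m P) *m (b *m P)^T = 2^-1 *: (b *m A *m b^T).
Proof.
move=> distP b b0.
pose G := P *m P^T.
have GE i j : G i j = (row i P *m (row j P)^T) 0 0.
  by rewrite /G tr_row -row_mul colE mulmxA -colE !mxE; apply: eq_bigr => k _; rewrite !mxE.
pose u : 'cV[R]_n := \col_i (G i i - 2^-1).
have GA : G = 2^-1 *: (A + u *m const_mx 1 + const_mx 1 *m u^T).
  apply/matrixP => i j; have := distP i j; rewrite sqr_euclid_norm.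
  have -> : ((row i P - row j P) *m (row i P - row j P)^T) 0 0
     = G i i + G j j - G i j - G j i.
    by rewrite linearB /= mulmxBl !mulmxBr !GE !mxE; ring.
  have -> : G j i = G i j.
    by rewrite -[in RHS](trmxK G) [RHS]mxE /G trmx_mul trmxK.
  rewrite !mxE !big_ord1 !mxE /=; lra.
rewrite trmx_mul -mulmxA (mulmxA P) -/G GA -scalemxAl -scalemxAr; congr (_ *: _).
have b0' : (const_mx 1 : 'rV[R]_n) *m b^T = 0.
  by rewrite -(trmx_const _ 1) -trmx_mul b0 trmx0.
rewrite !mulmxDl !mulmxDr -(mulmxA u) b0' mulmx0 mulmx0 !mulmxA b0 !mul0mx !addr0.
by [].
Qed.

(** This is [embedding_quadratic_form] at the mass 0 vector e_i - a. *)
Lemma sqdist_barycenter (R : realType) n m (A : 'M[R]_n) (P : 'M[R]_(n, m)) :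
  A^T = A ->
  (forall i j, euclid_norm (row i P - row j P) ^+ 2 = 1 - A i j) ->
  forall (a : 'rV[R]_n) i, a *m (const_mx 1 : 'cV[R]_n) = 1%:M ->
    euclid_norm (row i P - a *m P) ^+ 2 =
      2^-1 * (1 + (a *m A *m a^T) 0 0) - (a *m A) 0 i.
Proof.
move=> symA distP a i a1; pose e : 'rV[R]_n := delta_mx 0 i.
have Aii : A i i = 1.
  have := distP i i; rewrite subrr sqr_euclid_norm mul0mx mxE; lra.
have ea0 : (e - a) *m (const_mx 1 : 'cV[R]_n) = 0.
  by rewrite mulmxBl a1 -rowE; apply/matrixP => j k; rewrite !ord1 !mxE subrr.
rewrite rowE -mulmxBl sqr_euclid_norm (embedding_quadratic_form distP ea0).
rewrite linearB /= mulmxBl !mulmxBr !mulmxBl.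
have -> : e *m A *m e^T = 1%:M.
  by rewrite /e trmx_delta -rowE -colE; apply/matrixP => j k; rewrite !ord1 !mxE Aii.
have -> : e *m A *m a^T = a *m A *m e^T.
  by rewrite -[RHS]tr_mx11 !trmx_mul trmxK symA mulmxA.
have -> : a *m A *m e^T = ((a *m A) 0 i)%:M.
  by rewrite [LHS]mx11_scalar trmx_delta -colE [in LHS]mxE.
rewrite !mxE /=; lra.
Qed.

(** An affine dependence between the points is a mass 0 vector in the kernel of
    the quadratic form of A, hence 0. The points, completed by a coordinate 1,
    therefore form a square matrix with free rows, which spans everything. *)
Lemma barycentric_coordinates (R : realType) n (A : 'M[R]_n) (P : 'M[R]_(n, n.-1)) :
  (0 < n)%N -> posdefmx A ->
  (forall i j, euclid_norm (row i P - row j P) ^+ 2 = 1 - A i j) ->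
  forall c : 'rV[R]_(n.-1), exists a : 'rV[R]_n,
    a *m (const_mx 1 : 'cV[R]_n) = 1%:M /\ a *m P = c.
Proof.
move=> n0 [symA Apos] distP c.
pose M : 'M[R]_(n, n.-1 + 1) := row_mx P (const_mx 1).
have freeM : row_free M.
  rewrite -kermx_eq0; apply/eqP/row_matrixP => i; rewrite row0.
  apply/eqP/negPn/negP => /Apos; set b := row i _.
  have : b *m M = 0 by rewrite -row_mul mulmx_ker row0.
  rewrite mul_mx_row -row_mx0 => /eq_row_mx[bP b1].
  have := embedding_quadratic_form distP b1; rewrite bP mul0mx.
  by move/(congr1 (fun B : 'M[R]_1 => B 0 0)); rewrite !mxE; lra.
have fullM : row_full M by rewrite -col_leq_rank (eqP freeM) addn1 prednK.
have /row_fullP[B BM] := fullM.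
exists (row_mx c 1%:M *m B).
have : row_mx c 1%:M *m B *m M = row_mx c 1%:M by rewrite -mulmxA BM mulmx1.
by rewrite mul_mx_row => /eq_row_mx[-> ->].
Qed.

(** The weighting w = 1 A^-1 satisfies w A w^T = w 1^T, so its mass is a value
    of the form. *)
Lemma posdefmx_weight_gt0 (R : realType) n (A : 'M[R]_n) : (0 < n)%N -> posdefmx A ->
  0 < ((const_mx 1 : 'rV[R]_n) *m invmx A *m (const_mx 1 : 'cV[R]_n)) 0 0.
Proof.
move=> n0 posA; have [_ Apos] := posA.
set w := _ *m invmx A.
have wA : w *m A = const_mx 1 by rewrite mulmxKV ?posdefmx_unit.
have := Apos w; rewrite wA.
have -> : const_mx 1 *m w^T = w *m (const_mx 1 : 'cV[R]_n).
  by rewrite -[RHS]tr_mx11 [RHS]trmx_mul trmx_const.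
apply; apply/eqP => w0; move: wA; rewrite w0 mul0mx => /matrixP/(_ 0 (Ordinal n0)).
by rewrite !mxE => /esym/eqP; rewrite oner_eq0.
Qed.

(** Existence of a circumscribed sphere takes for centre the normalized
    weighting; for uniqueness of its radius, the barycentric coordinates a of any
    centre make a A constant, hence are proportional to the weighting, and mass 1
    fixes the factor. *)
Lemma circumradius_simplex (R : realType) n (A : 'M[R]_n) (P : 'M[R]_(n, n.-1)) :
  (0 < n)%N -> posdefmx A ->
  (forall i j, euclid_norm (row i P - row j P) ^+ 2 = 1 - A i j) ->
  2 * circumradius (range (fun i => row i P)) ^+ 2 =
    1 - (((const_mx 1 : 'rV[R]_n) *m invmx A
           *m (const_mx 1 : 'cV[R]_n)) 0 0)^-1.
Proof.
move=> n0 posA distP; have [symA _] := posA.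
have := posdefmx_weight_gt0 n0 posA.
set w := _ *m invmx A; set s := (_ *m _) 0 0 => s0.
have unitA := posdefmx_unit posA.
have wA : w *m A = const_mx 1 by rewrite mulmxKV.
have w1 : w *m (const_mx 1 : 'cV[R]_n) = s%:M by rewrite [LHS]mx11_scalar.
(* The constant value k of a A is also the value of the form at a. *)
have distE a k : a *m (const_mx 1 : 'cV[R]_n) = 1%:M -> a *m A = const_mx k ->
    forall i, euclid_norm (row i P - a *m P) ^+ 2 = 2^-1 * (1 - k).
  move=> a1 aA i; rewrite (sqdist_barycenter symA distP)// aA.
  have -> : const_mx k *m a^T = k%:M.
    rewrite -[const_mx k]trmxK -trmx_mul trmx_const.
    have -> : const_mx k = k *: (const_mx 1 : 'cV[R]_n).
      by apply/matrixP => ? ?; rewrite !mxE mulr1.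
    by rewrite -scalemxAr a1 linearZ /= trmx1 scalemx1.
  by rewrite !mxE /=; lra.
rewrite /circumradius; set C := [set r | _].
have [r0 [c sphc]] : C (xget 0 C).
  apply: xgetPex; pose a := s^-1 *: w.
  exists (Num.sqrt (2^-1 * (1 - s^-1))); split; first exact: sqrtr_ge0.
  exists (a *m P) => _ [i _ <-]; rewrite /sphere /=.
  rewrite -(distE a s^-1 _ _ i).
  - by rewrite sqrtr_sqr ger0_norm ?sqrtr_ge0.
  - by rewrite -scalemxAl w1 scale_scalar_mx mulVf ?gt_eqF.
  - by rewrite -scalemxAl wA; apply/matrixP => ? ?; rewrite !mxE mulr1.
have [a [a1 aP]] := barycentric_coordinates n0 posA distP c.
pose k := 2^-1 * (1 + (a *m A *m a^T) 0 0) - xget 0 C ^+ 2.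
have aAE i : (a *m A) 0 i = k.
  have normPc : euclid_norm (row i P - c) = xget 0 C by apply: sphc; exists i.
  by rewrite /k -normPc -aP (sqdist_barycenter symA distP)//; ring.
have aA : a *m A = const_mx k by apply/rowP => i; rewrite aAE mxE.
have defa : a = k *: w.
  rewrite -[LHS](mulmxK unitA) aA /w scalemxAl; congr (_ *m _).
  by apply/rowP => i; rewrite !mxE mulr1.
have ks : k * s = 1.
  have := a1; rewrite defa -scalemxAl w1 scale_scalar_mx.
  by move/(congr1 (fun B : 'M[R]_1 => B 0 0)); rewrite !mxE.
have kE : k = s^-1 by rewrite -[LHS](mulfK (lt0r_neq0 s0)) ks mul1r.
have <- : euclid_norm (row (Ordinal n0) P - c) = xget 0 C.
  by apply: sphc; exists (Ordinal n0).
by rewrite -aP (distE a k)// kE; lra.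
Qed.

(** * Matrices close to the identity *)

(** The perturbation of the form is at most n eta |v|^2, bounding each cross
    term by |v_i v_j| <= (v_i^2 + v_j^2) / 2. *)
Lemma posdefmx_near1 (R : realType) n (A : 'M[R]_n) (eta : R) :
  A^T = A -> (forall i j, `|A i j - (i == j)%:R| <= eta) -> n%:R * eta < 1 ->
  posdefmx A.
Proof.
move=> symA near1 neta; split=> // v v0.
pose E := A - 1%:M.
have EE i j : `|E i j| <= eta by rewrite /E !mxE.
have -> : A = 1%:M + E by rewrite /E addrC subrK.
rewrite mulmxDr mulmx1 mulmxDl mxE.
set N := (v *m v^T) 0 0.
have NE : N = \sum_i v 0 i ^+ 2.
  by rewrite /N mxE; apply: eq_bigr => i _; rewrite mxE expr2.
have N0 : 0 < N.
  rewrite lt0r NE sumr_ge0 ?andbT => [|i _]; last exact: sqr_ge0.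
  rewrite psumr_eq0 => [|i _]; last exact: sqr_ge0.
  apply: contra v0 => /allP v0; apply/eqP/rowP => i; apply/eqP.
  by have := v0 i; rewrite mem_index_enum sqrf_eq0 mxE; apply.
have : `|(v *m E *m v^T) 0 0| <= n%:R * eta * N.
  rewrite mxE; apply: le_trans (ler_norm_sum _ _ _) _.
  apply: (@le_trans _ _ (\sum_i \sum_j eta * (2^-1 * (v 0 i ^+ 2 + v 0 j ^+ 2)))).
    apply: ler_sum => i _; rewrite !mxE mulr_suml.
    apply: le_trans (ler_norm_sum _ _ _) _; apply: ler_sum => j _.
    rewrite !normrM mulrAC mulrC; apply: ler_pM => //.
    rewrite -(real_normK (num_real (v 0 i))) -(real_normK (num_real (v 0 j))).
    by have := sqr_ge0 (`|v 0 i| - `|v 0 j|); nra.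
  under eq_bigr => i _ do rewrite -mulr_sumr -mulr_sumr big_split /= sumr_const card_ord -NE.
  rewrite -mulr_sumr -mulr_sumr big_split /= sumr_const card_ord sumrMnl -NE.
  by rewrite -mulr_natl; lra.
move=> /ler_normlP[]; nra.
Qed.

(** Each coordinate of the weighting w is within eta W of 1, where W is the sum
    of the absolute values of its coordinates; this first bounds W itself by
    2 n, and then the distance from the mass of w to n. *)
Lemma weight_near1 (R : realType) n (A : 'M[R]_n) (eta : R) :
  A \in unitmx -> (forall i j, `|A i j - (i == j)%:R| <= eta) ->
  n%:R * eta <= 2^-1 ->
  `|((const_mx 1 : 'rV[R]_n) *m invmx A *m (const_mx 1 : 'cV[R]_n)) 0 0 - n%:R|
    <= 2 * n%:R ^+ 2 * eta.
Proof.
move=> unitA near1 neta.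
set w := _ *m invmx A.
have wA : w *m A = const_mx 1 by rewrite mulmxKV.
pose W := \sum_i `|w 0 i|.
have w1 i : `|w 0 i - 1| <= eta * W.
  have -> : w 0 i - 1 = - \sum_j w 0 j * (A j i - (j == i)%:R).
    have wAi : \sum_j w 0 j * A j i = 1.
      by have := congr1 (fun B : 'rV[R]_n => B 0 i) wA; rewrite [LHS]mxE [RHS]mxE.
    under [in RHS]eq_bigr => j _ do rewrite mulrBr.
    rewrite sumrB opprB wAi; congr (_ - _).
    rewrite (bigD1 i)//= eqxx mulr1 big1 ?addr0// => j /negPf ->.
    by rewrite mulr0.
  rewrite normrN; apply: le_trans (ler_norm_sum _ _ _) _.
  rewrite /W mulr_sumr; apply: ler_sum => j _.
  by rewrite normrM mulrC ler_wpM2r.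
have W0 : 0 <= W by apply: sumr_ge0 => i _.
have sumw1 : \sum_i `|w 0 i - 1| <= n%:R * eta * W.
  apply: le_trans (ler_sum _ (fun i _ => w1 i)) _.
  by rewrite sumr_const card_ord -[X in X <= _]mulr_natl mulrA.
have Wn : W <= n%:R + n%:R * eta * W.
  apply: le_trans (lerD (lexx _) sumw1).
  have -> : n%:R = \sum_(i < n) (1 : R) by rewrite sumr_const card_ord.
  rewrite -big_split; apply: ler_sum => i _ /=.
  by rewrite -{1}(subrK 1 (w 0 i)) addrC (le_trans (ler_normD _ _))// normr1.
have -> : (w *m (const_mx 1 : 'cV[R]_n)) 0 0 - n%:R = \sum_i (w 0 i - 1).
  rewrite sumrB sumr_const card_ord mxE; congr (_ - _).
  by apply: eq_bigr => i _; rewrite [const_mx _ i _]mxE mulr1.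
apply: le_trans (ler_norm_sum _ _ _) _; apply: le_trans sumw1 _.
(* The hypothesis on eta allows W to be absorbed in the left-hand side. *)
have W2n : W <= 2 * n%:R by nra.
case: (posnP n) => [->|n0]; first by rewrite !mul0r expr0n mulr0 mul0r.
have eta0 : 0 <= eta by apply: le_trans (near1 (Ordinal n0) (Ordinal n0)).
have : 0 <= n%:R * eta by apply: mulr_ge0.
by nra.
Qed.

(** * Similarity matrices of finite metric spaces *)

Lemma similarity_embedding_exists (R : realType) (X : finType) (d : X -> X -> R) :
  (0 < #|X|)%N -> (forall x, d x x = 0) -> posdefmx (similarity_mx d) ->
  exists phi, similarity_embedding d phi.
Proof.
move=> X0 dxx posZ; have [P normP] := euclid_embedding_exists X0 posZ.
exists (fun x => row (enum_rank x) P); split=> // x y.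
set i := enum_rank x; set j := enum_rank y.
pose b : 'rV[R]_#|X| := delta_mx 0 i - delta_mx 0 j.
have b0 : b *m (const_mx 1 : 'cV[R]_#|X|) = 0.
  by rewrite mulmxBl -!rowE; apply/matrixP => k l; rewrite !mxE subrr.
rewrite !rowE -mulmxBl sqr_euclid_norm (normP b b0).
have ZE k l : (delta_mx 0 k : 'rV[R]_#|X|) *m similarity_mx d
      *m (delta_mx 0 l : 'rV[R]_#|X|)^T
    = (similarity_mx d k l)%:M.
  by rewrite [LHS]mx11_scalar trmx_delta -rowE -colE [in LHS]mxE [in LHS]mxE.
rewrite /b linearB /= mulmxBl !mulmxBr !mulmxBl !ZE !mxE /= !enum_rankK !dxx.
have symd : d y x = d x y.
  have [/matrixP/(_ i j)] := posZ; rewrite !mxE !enum_rankK => /expR_inj.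
  by move/oppr_inj.
by rewrite symd oppr0 expR0; lra.
Qed.

Lemma circumradius_similarity_image (R : realType) (X : finType) (d : X -> X -> R) :
  (0 < #|X|)%N -> (forall x, d x x = 0) -> posdefmx (similarity_mx d) ->
  2 * circumradius (similarity_image d) ^+ 2 = 1 - (magnitude d)^-1.
Proof.
move=> X0 dxx posZ.
have := xgetPex (fun=> 0) (similarity_embedding_exists X0 dxx posZ).
rewrite /similarity_image; set phi := xget _ _ => -[_ distphi].
pose P := \matrix_(i < #|X|) phi (enum_val i).
have -> : range phi = range (fun i => row i P).
  apply/seteqP; split=> _ [x _ <-].
    by exists (enum_rank x) => //; rewrite rowK enum_rankK.
  by exists (enum_val x) => //; rewrite rowK.
by apply: circumradius_simplex => // i j; rewrite !rowK distphi !mxE.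
Qed.

Lemma similarity_mx_scale_near1 (R : realType) (X : finMetricType R) (eta : R) :
  0 < eta ->
  \forall t \near +oo, forall i j,
    `|similarity_mx (scale_dist t (@mdist R X)) i j - (i == j)%:R| <= eta.
Proof.
move=> eta0.
apply: filter_forall => i; apply: filter_forall => j.
have [<-|ij] := eqVneq i j.
  by apply: nearW => t; rewrite mxE /scale_dist mdistxx mulr0 oppr0 expR0 subrr normr0 ltW.
have d0 : 0 < mdist (enum_val i) (enum_val j).
  by rewrite mdist_gt0 (inj_eq enum_val_inj).
near=> t; rewrite mxE subr0 ger0_norm ?expR_ge0// /scale_dist.
rewrite -[leRHS]lnK ?posrE// ler_expR lerNl -ler_pdivrMr//.
Unshelve. all: by end_near. Qed.

(** The number eta is chosen so small that [posdefmx_near1] and [weight_near1]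
    both apply, and that the bound of the latter is at most eps. *)
Lemma magnitude_scale_cvg (R : realType) (X : finMetricType R) (eps : R) :
  (0 < #|X|)%N -> 0 < eps ->
  \forall t \near +oo, posdefmx (similarity_mx (scale_dist t (@mdist R X))) /\
    `|magnitude (scale_dist t (@mdist R X)) - #|X|%:R| <= eps.
Proof.
move=> X0 eps0; set n : R := #|X|%:R.
have n0 : 0 < n by rewrite ltr0n.
pose eta := Num.min ((4 * n)^-1) (eps / (2 * n ^+ 2)).
have eta0 : 0 < eta by rewrite lt_min invr_gt0 divr_gt0 ?mulr_gt0 ?exprn_gt0.
have neta : n * eta <= 4^-1.
  have -> : (4^-1 : R) = n * (4 * n)^-1 by field; rewrite gt_eqF.
  by rewrite ler_pM2l// ge_min lexx.
have n2eta : 2 * n ^+ 2 * eta <= eps.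
  rewrite mulrC -ler_pdivlMr ?mulr_gt0 ?exprn_gt0//.
  by rewrite /eta ge_min lexx orbT.
near=> t.
have near1 : forall i j,
    `|similarity_mx (scale_dist t (@mdist R X)) i j - (i == j)%:R| <= eta.
  by near: t; exact: similarity_mx_scale_near1.
have posZ : posdefmx (similarity_mx (scale_dist t (@mdist R X))).
  apply: (posdefmx_near1 _ near1); last by rewrite -/n; lra.
  by apply/matrixP => i j; rewrite !mxE /scale_dist metric_sym.
split=> //; apply: le_trans n2eta.
by apply: (weight_near1 _ near1); rewrite ?posdefmx_unit// -/n; lra.
Unshelve. all: by end_near. Qed.

Theorem theorem3p1 (R : realType) (X : finMetricType R) (hX : (0 < #|X|)%N) :
  let n : R := #|X|%:R in
  let tX (t : R) : X -> X -> R := scale_dist t mdist in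
  let q (t : R) : R^o := n - magnitude (tX t) in
  let S (t : R) := similarity_image (tX t) in
  q ~_(+oo) (fun t =>
    n ^+ 2 * ((n - 1) / n - 2 * circumradius (S t) ^+ 2)).
Proof.
move=> n tX q S.
have n0 : 0 < n by rewrite ltr0n.
apply/eqaddoP => eps eps0 /=.
near=> t.
have [posZ smag] : posdefmx (similarity_mx (tX t)) /\
    `|magnitude (tX t) - n| <= eps * n.
  by near: t; apply: magnitude_scale_cvg; rewrite ?mulr_gt0.
have tXxx x : tX t x x = 0 by rewrite /tX /scale_dist mdistxx mulr0.
have magn0 : 0 < magnitude (tX t) := posdefmx_weight_gt0 hX posZ.
suff: `|q t - n ^+ 2 * ((n - 1) / n - 2 * circumradius (S t) ^+ 2)| <=
    eps * `|n ^+ 2 * ((n - 1) / n - 2 * circumradius (S t) ^+ 2)| by [].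
rewrite /q /S (circumradius_similarity_image hX tXxx posZ).
move: (magnitude (tX t)) smag magn0 => s sn s0.
set g := n ^+ 2 * _.
(* Here g = n (n - s) / s by the formula for the circumradius. *)
have -> : n - s - g = (s - n) / n * g.
  by rewrite /g; field; rewrite !gt_eqF.
rewrite normrM ler_wpM2r// normrM normfV (gtr0_norm n0).
by rewrite ler_pdivrMr.
Unshelve. all: by end_near. Qed.
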